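(* The inequality $$1-\sqrt[n]{\tfrac{2}{3}} < B_n(D)$$ is true for any complete bounded $n$-circular domain $D\subset\mathbf{C}^n$.
   Context: A complete $n$-circular (complete Reinhardt) domain is a nonempty open connected set $D\subset\mathbf{C}^n$ such that if $z\in D$ and $|w_j|\le|z_j|$ for $j=1,\dots,n$, then $w\in D$. Multi-indices $\alpha=(\alpha_1,\dots,\alpha_n)$ have non-negative integer entries and $z^\alpha=z_1^{\alpha_1}\cdots z_n^{\alpha_n}$. For $r>0$ put $D_r=r\cdot D=\{rz: z\in D\}$. $B_n(D)$ denotes the biggest number $r$ with the following property: if a power series $\sum_\alpha c_\alpha z^\alpha$ converges in $D$ and satisfies $\left|\sum_\alpha c_\alpha z^\alpha\right|<1$ for all $z\in D$, then $$\sum_\alpha \sup_{z\in D_r}|c_\alpha z^\alpha|<1.$$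
   Formalization: The inequality is proved for n ≥ 2: for n = 1 every complete bounded circular domain is a disc with B_1(D) = 1/3 = 1 − 2/3, so the strict inequality fails; the ''biggest number'' r is taken as the supremum of admissible r > 0. *)

(* Defs.v *)
From HB Require Import structures.
From mathcomp Require Import all_boot all_order all_algebra.
From mathcomp Require Import complex.
From mathcomp Require Import all_classical all_reals all_analysis.
From mathcomp.analysis.showcase Require Import summability.

Set Implicit Arguments.
Unset Strict Implicit.
Unset Printing Implicit Defensive.

Import Order.TTheory GRing.Theory Num.Theory numFieldNormedType.Exports.

Local Open Scope classical_set_scope.
Local Open Scope ring_scope.
Local Open Scope complex_scope.

(* The standard topology and norm of a [numFieldType], made available on the
   type [R[i]] itself. *)
HB.instance Definition _ (R : realType) := NormedModule.copy R[i] R[i]^o.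

Section BohrRadius.
Variables (R : realType) (n : nat).
Implicit Types (D : set 'rV[R[i]]_n) (c : {ffun 'I_n -> nat} -> R[i]) (r : R).

Definition complete_circular_domain D :=
  [/\ D !=set0, open D, connected D &
      forall z w : 'rV[R[i]]_n,
        D z -> (forall j, `|w ord0 j| <= `|z ord0 j|) -> D w].

Definition monomial (a : {ffun 'I_n -> nat}) (z : 'rV[R[i]]_n) : R[i] :=
  \prod_(j < n) z ord0 j ^+ a j.

Definition power_series_terms c (z : 'rV[R[i]]_n)
    (a : {ffun 'I_n -> nat}) : R[i] := c a * monomial a z.

(* Convergence of a multiple series is that of the net of its finite partial
   sums, i.e. unconditional convergence; on a complete circular domain this
   agrees with every other usual reading, by Abel's lemma. *)
Definition power_series_cvg_in D c :=
  forall z, D z -> cvg (partial_sum (power_series_terms c z) @ totally).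

Definition power_series_sum c (z : 'rV[R[i]]_n) : R[i] :=
  summability.sum (power_series_terms c z).

Definition dilation r D : set 'rV[R[i]]_n := [set r%:C *: z | z in D].

(* [complex.Re `|x|] is the modulus of [x] as an element of [R]: the norm of [R[i]]
   takes its values in [R[i]]. *)
Definition majorant_series D c r : \bar R :=
  \esum_(a in [set: {ffun 'I_n -> nat}])
    ereal_sup [set (complex.Re `|power_series_terms c z a|)%:E | z in dilation r D].

Definition bohr_property D r :=
  forall c, power_series_cvg_in D c ->
    (forall z, D z -> `|power_series_sum c z| < 1) ->
    (majorant_series D c r < 1)%E.

(* The set of admissible [r] is an interval starting at 0, so its biggest
   element is its supremum. *)
Definition bohr_radius D : R := sup [set r | 0 < r /\ bohr_property D r].

End BohrRadius.

(* Main.v *)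
(* Let [a = |c_0|] and [s = 1 - a ^ 2]. Slicing by complex lines through the
   origin and F. Wiener's inequality [|p_m| <= 1 - |p_0| ^ 2] for one variable
   bound every homogeneous part of the series by [s] on [D]; Parseval's identity
   on the torus then bounds the sum of [|c_alpha z ^ alpha| ^ 2] over any set of
   [alpha] of equal positive degree by [s ^ 2]. Bounding each term separately,
   the majorant series is at most [a + s ((1 - r) ^ (- n) - 1)], which is [< 1]
   as soon as [(1 - r) ^ n >= 2 / 3].

   The strict inequality comes from the monomials [z_0 z_1] and [z_0 ^ 2]: by
   Parseval their two coefficients cannot both be nearly extremal, so one of
   these terms is at most [(1 - eps) s] with [eps] depending only on [D], and a
   slightly larger [r] is still admissible. *)
Require Import Defs.
From mathcomp Require Import all_boot all_order all_algebra.
From mathcomp Require Import separable cyclic cyclotomic finmap.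
From mathcomp Require Import complex.
From mathcomp Require Import all_classical all_reals all_analysis.
From mathcomp.analysis.showcase Require Import summability.
From mathcomp Require Import ring lra.

Set Implicit Arguments.
Unset Strict Implicit.
Unset Printing Implicit Defensive.

Import Order.TTheory GRing.Theory Num.Theory numFieldNormedType.Exports.

Local Open Scope classical_set_scope.
Local Open Scope ring_scope.

(** * Polynomials on the unit circle *)

Lemma ler_sum_uniq_sub (K : numDomainType) (I : eqType) (s t : seq I)
    (f : I -> K) : uniq s -> uniq t -> {subset s <= t} ->
  (forall i, 0 <= f i) -> \sum_(i <- s) f i <= \sum_(i <- t) f i.
Proof.
move=> us ut st f0; rewrite [leRHS](bigID (mem s)) /= -[X in _ <= X + _]big_filter.
rewrite (perm_big [seq i <- t | i \in s]) /=; first by rewrite lerDl sumr_ge0.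
apply: uniq_perm => //; first exact: filter_uniq.
by move=> i; rewrite mem_filter; case: (boolP (i \in s)) => //= /st.
Qed.

Section PolynomialOnCircle.
Variable F : numClosedFieldType.
Implicit Types (p q : {poly F}) (M : F).

(** ['X^n - 1] is separable in characteristic zero, so it has [n] distinct roots, and these include
    a primitive one. *)
Lemma prim_root_exists n : (0 < n)%N -> exists z : F, n.-primitive_root z.
Proof.
pose p : {poly F} := 'X^n - 1; have [r Dp] := closed_field_poly_normal p.
move=> n_gt0; rewrite (monicP _) ?monicXnsubC // scale1r in Dp.
have rn1: all n.-unity_root r by apply/allP => z; rewrite -root_prod_XsubC -Dp.
have sz_r: (n < (size r).+1)%N.
  by rewrite -(size_prod_XsubC r id) -Dp size_XnsubC.
have [|z] := hasP (has_prim_root n_gt0 rn1 _ sz_r); last by exists z.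
by rewrite -separable_prod_XsubC -Dp separable_Xn_sub_1 // pnatr_eq0 -lt0n.
Qed.

Lemma prim_root_norm n (z : F) : n.-primitive_root z -> `|z| = 1.
Proof.
move=> zP; have n0 := prim_order_gt0 zP; apply/eqP.
by rewrite -(@pexpr_eq1 _ _ n) // -normrX (prim_expr_order zP) normr1.
Qed.

Lemma prim_root_orthogonal n (z : F) (i j : 'I_n) : n.-primitive_root z ->
  \sum_(k < n) (z ^+ k) ^+ i * ((z ^+ k) ^+ j)^* = (i == j)%:R *+ n.
Proof.
move=> zP; have z1 := prim_root_norm zP.
have zj1 m : z ^+ m * (z ^+ m)^* = 1.
  by rewrite -normCK normrX z1 !expr1n.
(* As [z] has modulus 1, [w] is [z ^ (i - j)], and the sum becomes a geometric one over an [n]-th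
   root of unity. *)
pose w := z ^+ i * (z ^+ j)^*.
have -> : \sum_(k < n) (z ^+ k) ^+ i * ((z ^+ k) ^+ j)^* = \sum_(k < n) w ^+ k.
  apply: eq_bigr => k _; rewrite /w exprMn -rmorphXn -!exprM.
  by rewrite (mulnC k i) (mulnC k j).
case: eqVneq => [ij|ij].
  rewrite /w ij zj1 (eq_bigr (fun=> 1)) ?sumr_const ?card_ord // => k _.
  by rewrite expr1n.
rewrite mul0rn.
have wn : w ^+ n = 1.
  rewrite /w exprMn -rmorphXn -!exprM mulnC (mulnC j) !exprM.
  by rewrite (prim_expr_order zP) !expr1n rmorph1 mulr1.
have w1 : w != 1.
  apply: contra ij => /eqP /(congr1 ( *%R^~ (z ^+ j))).
  rewrite /w -mulrA (mulrC (_^*)) zj1 mulr1 mul1r => /eqP.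
  by rewrite (eq_prim_root_expr zP) !modn_small.
apply/eqP; have := subrX1 w n; rewrite wn subrr => /esym/eqP.
by rewrite mulf_eq0 subr_eq0 (negPf w1).
Qed.

(** Averaging over roots of unity replaces integration over the circle; with [size p <= n] no two
    exponents of [p] agree modulo [n], so orthogonality isolates the squares. *)
Lemma Parseval_prim_root n (z : F) p : n.-primitive_root z -> (size p <= n)%N ->
  \sum_(k < n) `|p.[z ^+ k]| ^+ 2 = (\sum_(i < n) `|p`_i| ^+ 2) *+ n.
Proof.
move=> zP sp.
have sq k : `|p.[z ^+ k]| ^+ 2 = \sum_(i < n) \sum_(j < n)
    p`_i * (p`_j)^* * ((z ^+ k) ^+ i * ((z ^+ k) ^+ j)^* ).
  rewrite normCK (horner_coef_wide _ sp) rmorph_sum /= mulr_suml.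
  apply: eq_bigr => i _; rewrite mulr_sumr; apply: eq_bigr => j _.
  by rewrite rmorphM /=; ring.
under eq_bigr do rewrite sq.
rewrite exchange_big -sumrMnl /=; apply: eq_bigr => i _.
rewrite exchange_big /= (bigD1 i) //= [X in _ + X]big1 ?addr0 => [|j ji].
  by rewrite -mulr_sumr (prim_root_orthogonal i i zP) eqxx mulrnAr mulr1 normCK.
by rewrite -mulr_sumr (prim_root_orthogonal i j zP) eq_sym (negPf ji) mul0rn mulr0.
Qed.

(** Parseval on both sides reduces this to bounding [p * q] by [M] times [q] pointwise at the roots
    of unity. *)
Lemma Bessel_mul_poly p q M n : (size (p * q)%R <= n)%N -> (size q <= n)%N ->
  (forall z, `|z| = 1 -> `|p.[z]| <= M) ->
  \sum_(i < n) `|(p * q)`_i| ^+ 2 <= M ^+ 2 * \sum_(i < n) `|q`_i| ^+ 2.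
Proof.
move=> spq sq pM.
have [->|n0] := posnP n; first by rewrite !big_ord0 mulr0.
have [z zP] := prim_root_exists n0.
rewrite -(ler_pMn2r n0) -mulrnAr -!(Parseval_prim_root zP) //.
rewrite mulr_sumr ler_sum // => k _; rewrite hornerM normrM exprMn.
have pzM : `|p.[z ^+ k]| <= M.
  by apply: pM; rewrite normrX (prim_root_norm zP) expr1n.
by rewrite ler_wpM2r ?exprn_ge0 // lerXn2r ?nnegrE // (le_trans _ pzM).
Qed.

Lemma Bessel_poly p M (s : seq nat) : uniq s ->
  (forall z, `|z| = 1 -> `|p.[z]| <= M) ->
  \sum_(i <- s) `|p`_i| ^+ 2 <= M ^+ 2.
Proof.
move=> us pM.
(* [n] bounds the sizes of [p] and [1] and exceeds every index in [s], so the sum over [s] is part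
   of a sum over [i < n]. *)
pose n := (maxn (size p) (maxn 1 (\max_(i <- s) i.+1)))%N.
have np : (size p <= n)%N by rewrite leq_maxl.
have n1 : (0 < n)%N by rewrite !leq_max /= orbT.
have := @Bessel_mul_poly p 1 M n; rewrite mulr1 size_poly1.
move=> /(_ np n1 pM).
have -> : \sum_(i < n) `|(1 : {poly F})`_i| ^+ 2 = 1.
  rewrite (bigD1 (Ordinal n1)) //= coef1 eqxx normr1 expr1n big1 ?addr0 // => i.
  rewrite -val_eqE /= coef1 => /negPf ->.
  by rewrite normr0 expr0n.
rewrite mulr1; apply: le_trans.
rewrite -(big_mkord xpredT (fun i => `|p`_i| ^+ 2)).
apply: ler_sum_uniq_sub => [//||i si|i]; rewrite ?iota_uniq ?exprn_ge0 //.
by rewrite mem_index_iota /= !leq_max (leq_bigmax_seq (F := S)) ?orbT.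
Qed.

(* Comparing [p * q] and [q] in the mean square, for [q = x + y 'X^m] with
   [x] and [y] chosen to optimize the resulting bound. *)
Lemma Wiener_coef_bound p M m : (0 < m)%N -> `|p`_0| < M ->
  (forall z, `|z| = 1 -> `|p.[z]| <= M) ->
  `|p`_m| * M <= M ^+ 2 - `|p`_0| ^+ 2.
Proof.
move=> m0 p0M pM.
have M0 : 0 < M by exact: le_lt_trans p0M.
pose x := M ^+ 2 - `|p`_0| ^+ 2.
have x0 : 0 < x by rewrite subr_gt0 ltrXn2r ?nnegrE // ltW.
pose y := (p`_0)^* * p`_m.
pose q := x%:P + y *: 'X^m.
have q0 : q`_0 = x by rewrite coefD coefC coefZ coefXn (ltn_eqF m0) mulr0 addr0.
have qm : q`_m = y by rewrite coefD coefC coefZ coefXn eqxx mulr1 (gtn_eqF m0) add0r.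
have qi i : i != 0%N -> i != m -> q`_i = 0.
  by move=> i0 im; rewrite coefD coefC coefZ coefXn (negPf i0) (negPf im) mulr0 addr0.
have pq0 : (p * q)`_0 = p`_0 * x by rewrite coef0M q0.
have pqm : (p * q)`_m = p`_m * M ^+ 2.
  rewrite /q mulrDr coefD coefMC -scalerAr coefZ coefMXn ltnn subnn.
  by rewrite /y /x normCK; ring.
pose n := maxn m.+1 (maxn (size (p * q)%R) (size q)).
have mn : (m < n)%N by rewrite leq_max leqnn.
have npq : (size (p * q)%R <= n)%N by rewrite !leq_max leqnn /= orbT.
have nq : (size q <= n)%N by rewrite !leq_max leqnn /= !orbT.
have n0 : (0 < n)%N by exact: leq_ltn_trans mn.
have := Bessel_mul_poly npq nq pM.
(* Only the coefficients of index 0 and [m] matter: [q] has no others, and those of [p * q] may be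
   dropped. *)
have D2 (f : nat -> F) : \sum_(i < n) f i = f 0%N + f m +
    \sum_(i < n | (i != Ordinal n0) && (i != Ordinal mn)) f i.
  rewrite (bigD1 (Ordinal n0)) //= (bigD1 (Ordinal mn)) ?addrA //=.
  by rewrite -val_eqE /= -lt0n.
rewrite !(D2 (fun i => `|_`_i| ^+ 2)) [X in _ <= _ * (_ + X)]big1 => [|i]; last first.
  by rewrite -!val_eqE /= => /andP[i0 im]; rewrite qi // normr0 expr0n.
rewrite addr0 q0 qm pq0 pqm => H.
have {}H : `|p`_0 * x| ^+ 2 + `|p`_m * M ^+ 2| ^+ 2 <= M ^+ 2 * (`|x| ^+ 2 + `|y| ^+ 2).
  by apply: le_trans H; rewrite lerDl sumr_ge0 // => i _; rewrite exprn_ge0.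
move: H; rewrite /y (normrM p`_0) (normrM p`_m) (normrM _^*) normrX norm_conjC.
rewrite (ger0_norm (ltW x0)) (ger0_norm (ltW M0)).
set a := `|p`_0|; set b := `|p`_m| => H.
have b0 : 0 <= b by exact: normr_ge0.
(* Squared and multiplied by [x > 0], the goal is [(b * M) ^ 2 * x <= x ^ 2 * x], which is [H]
   rearranged using [x = M ^ 2 - a ^ 2]. *)
rewrite -(@ler_pXn2r _ 2) ?nnegrE ?mulr_ge0 ?(ltW x0) ?(ltW M0) //.
rewrite -(ler_pM2r x0) -subr_ge0.
move: H; rewrite -subr_ge0; congr (0 <= _).
by rewrite /x -/a; ring.
Qed.

End PolynomialOnCircle.

(** * Finite multiple power sums on the torus *)

(** The residue modulo [k] recovers the lowest digit; cancelling [k] leaves an expansion with one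
    digit fewer. *)
Lemma base_expansion_inj n k (f g : 'I_n -> nat) :
  (forall j, f j < k)%N -> (forall j, g j < k)%N ->
  (\sum_(j < n) f j * k ^ j = \sum_(j < n) g j * k ^ j)%N -> f =1 g.
Proof.
elim: n f g => [|n IH] f g fk gk; first by move=> _ [].
have k0 : (0 < k)%N by exact: leq_ltn_trans (fk ord0).
have split_sum (h : 'I_n.+1 -> nat) : (\sum_(j < n.+1) h j * k ^ j =
    h ord0 + (\sum_(j < n) h (lift ord0 j) * k ^ j) * k)%N.
  rewrite big_ord_recl /= muln1 big_distrl /=; congr addn.
  by apply: eq_bigr => i _; rewrite expnSr mulnA.
rewrite !split_sum => fg.
have fg0 : f ord0 = g ord0.
  by have := congr1 (modn^~ k) fg; rewrite ![(_ ord0 + _)%N]addnC !modnMDl !modn_small.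
move: fg; rewrite fg0 => /addnI/eqP; rewrite eqn_pmul2r // => /eqP fgS j.
have [i ->|-> //] := unliftP ord0 j.
by apply: (IH (f \o lift ord0) (g \o lift ord0)) => //= i0.
Qed.

Section FinitePowerSums.
Variables (F : numClosedFieldType) (n : nat).
Local Notation index := {ffun 'I_n -> nat}.
Implicit Types (a b : index) (S T : seq index) (u : index -> F) (w : 'I_n -> F)
  (M : F).

Definition index0 : index := [ffun=> 0%N].
Definition degree a := (\sum_j a j)%N.

Lemma degree_eq0 a : (degree a == 0%N) = (a == index0).
Proof.
rewrite sum_nat_eq0; apply/forallP/eqP => [a0|-> j]; last by rewrite ffunE.
by apply/ffunP => j; rewrite ffunE; apply/eqP/(implyP (a0 j)).
Qed.

Lemma leq_degree a j : (a j <= degree a)%N.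
Proof. by rewrite /degree (bigD1 j) //= leq_addr. Qed.

(** On the complex line through [w] the sum is a polynomial in one variable whose coefficient of
    index [m] is the part of degree [m]; Wiener's bound applies to it. *)
Lemma homogeneous_part_bound S u M m : uniq S -> index0 \in S -> (0 < m)%N ->
  `|u index0| < M ->
  (forall w, (forall j, `|w j| = 1) ->
    `|\sum_(a <- S) u a * \prod_j w j ^+ a j| <= M) ->
  forall w, (forall j, `|w j| = 1) ->
    `|\sum_(a <- S | degree a == m) u a * \prod_j w j ^+ a j| * M
      <= M ^+ 2 - `|u index0| ^+ 2.
Proof.
move=> uS S0 m0 u0M uM w w1.
pose p := \sum_(a <- S) (u a * \prod_j w j ^+ a j) *: 'X^(degree a).
have pE k : p`_k = \sum_(a <- S | degree a == k) u a * \prod_j w j ^+ a j.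
  rewrite coef_sum [RHS]big_mkcond; apply: eq_bigr => a _.
  by rewrite coefZ coefXn eq_sym; case: eqP; rewrite ?mulr1 ?mulr0.
have p0 : p`_0 = u index0.
  rewrite pE (eq_bigl (pred1 index0)); last by move=> a; rewrite degree_eq0.
  rewrite -big_filter filter_pred1_uniq // big_seq1 big1 ?mulr1 // => j _.
  by rewrite ffunE expr0.
rewrite -pE -p0; apply: Wiener_coef_bound; rewrite ?p0 // => z z1.
rewrite -[p]/(\sum_(a <- S) _) horner_sum.
rewrite (eq_bigr (fun a => u a * \prod_j (z * w j) ^+ a j)).
  by apply: uM => j; rewrite normrM z1 w1 mulr1.
move=> a _; rewrite hornerZ hornerXn -mulrA; congr (_ * _).
rewrite /degree expr_sum -big_split /=; apply: eq_bigr => j _.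
by rewrite exprMn mulrC.
Qed.

(* The substitution [w_j = z ^ ((m + 1) ^ j)] separates the monomials of
   degree [m], which turns the sum into a polynomial in [z]. *)
Lemma homogeneous_coef_bound S T u M m : uniq S -> index0 \in S -> (0 < m)%N ->
  `|u index0| < M ->
  (forall w, (forall j, `|w j| = 1) ->
    `|\sum_(a <- S) u a * \prod_j w j ^+ a j| <= M) ->
  uniq T -> {subset T <= S} -> {in T, forall a, degree a = m} ->
  (\sum_(a <- T) `|u a| ^+ 2) * M ^+ 2 <= (M ^+ 2 - `|u index0| ^+ 2) ^+ 2.
Proof.
move=> uS S0 m0 u0M uM uT TS Tm.
have M0 : 0 < M by exact: le_lt_trans u0M.
pose e a := (\sum_(j < n) a j * m.+1 ^ j)%N.
have e_inj : {in [pred a | degree a == m] &, injective e}.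
  move=> a b /eqP am /eqP bm; rewrite /e => ab; apply/ffunP.
  by apply: base_expansion_inj ab => j; rewrite ltnS;
    [rewrite -am|rewrite -bm]; exact: leq_degree.
pose p := \sum_(a <- S | degree a == m) u a *: 'X^(e a).
have pe a : a \in T -> p`_(e a) = u a.
  move=> aT; have /eqP am := Tm _ aT.
  rewrite coef_sum (eq_bigr (fun b => if b == a then u b else 0)).
    rewrite -big_mkcondr /= (eq_bigl (pred1 a)).
      by rewrite -big_filter filter_pred1_uniq ?TS // big_seq1.
    by move=> b /=; case: (eqVneq b a) => [->|]; rewrite ?am ?andbF.
  move=> b bm; rewrite coefZ coefXn (inj_in_eq e_inj) // eq_sym.
  by case: eqP; rewrite ?mulr1 ?mulr0.
(* For [z] on the circle, [p] takes the value of the part of degree [m] at a torus point, so the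
   previous bound divided by [M] feeds Bessel's inequality. *)
have : \sum_(i <- map e T) `|p`_i| ^+ 2 <= ((M ^+ 2 - `|u index0| ^+ 2) / M) ^+ 2.
  apply: Bessel_poly.
    rewrite map_inj_in_uniq // => a b aT bT.
    by apply: e_inj; rewrite inE; apply/eqP/Tm.
  move=> z z1; rewrite ler_pdivlMr //.
  have -> : p.[z] = \sum_(a <- S | degree a == m) u a *
      \prod_(j < n) (z ^+ (m.+1 ^ j)) ^+ a j.
    rewrite -[p]/(\sum_(a <- S | _) _) horner_sum; apply: eq_bigr => a _.
    rewrite hornerZ hornerXn /e expr_sum; congr (_ * _).
    by apply: eq_bigr => j _; rewrite -exprM mulnC.
  apply: (homogeneous_part_bound uS) => // j.
  by rewrite normrX z1 expr1n.
rewrite big_map (eq_big_seq (fun a => `|u a| ^+ 2)) => [|a aT]; last by rewrite pe.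
by rewrite expr_div_n ler_pdivlMr // exprn_gt0.
Qed.

End FinitePowerSums.

(** * Unconditional convergence *)

Local Open Scope complex_scope.

#[local] Existing Instance totally_filter.

Section UnconditionalConvergence.
Variables (R : realType) (I : choiceType).
Implicit Types (u : I -> R[i]) (e : R) (A B : {fset I}).

Lemma normc_ge_Im (x : R[i]) : `|complex.Im x|%:C <= `|x|.
Proof.
have := normc_ge_Re (x * 'i); rewrite normrM; case: x => a b /=.
rewrite !(mulr0, mul0r, mulr1, add0r, sub0r, normrN) normCi ?mulr1 //.
Qed.

Lemma normc_le_ReIm (x : R[i]) :
  `|x| <= (`|complex.Re x| + `|complex.Im x|)%:C.
Proof.
have real_norm (a : R) : `|a%:C| = `|a|%:C.
  by rewrite normc_def /= expr0n /= addr0 sqrtr_sqr.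
rewrite [x in `|x|]complexE rmorphD /= (le_trans (ler_normD _ _)) // normrM.
by rewrite !real_norm normCi mul1r.
Qed.

Lemma partial_sumE u A : partial_sum u A = \sum_(i <- A) u i.
Proof. by rewrite big_seq_fsetE. Qed.

Lemma partial_sumU u A B : [disjoint A & B]%fset ->
  partial_sum u (A `|` B)%fset = partial_sum u A + partial_sum u B.
Proof.
move=> AB; rewrite !partial_sumE (big_fsetID _ (mem A)) /=.
congr (_ + _); congr (\sum_(i <- _) _); congr enum_fset; apply/fsetP => i; rewrite !inE /=.
  by case: (i \in A); rewrite ?andbF.
have [iA|iA] := boolP (i \in A); rewrite ?andbT //=.
by rewrite (negPf (fdisjointP AB _ iA)).
Qed.

(** The nonnegative and the negative terms form two subsums, each at most [d] in absolute value. *)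
Lemma sum_norm_le_of_subsums (f : I -> R) (d : R) (s : seq I) :
  (forall P : pred I, `|\sum_(i <- s | P i) f i| <= d) ->
  \sum_(i <- s) `|f i| <= d *+ 2.
Proof.
move=> fd; rewrite (bigID (fun i => 0 <= f i)) /= mulr2n.
apply: lerD.
  rewrite (eq_bigr f) => [|i /ger0_norm //].
  exact: le_trans (ler_norm _) (fd _).
rewrite (eq_bigr (fun i => - f i)) => [|i]; last by rewrite -ltNge => /ltr0_norm.
by rewrite sumrN; apply: le_trans (ler_norm _) _; rewrite normrN.
Qed.

(* Unconditional convergence is absolute: bounding the partial sums over all
   subsets controls the sums of the moduli. *)
Lemma cvg_partial_sum_tail u e : cvg (partial_sum u @ totally) -> 0 < e ->
  exists A, forall B, [disjoint A & B]%fset ->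
    \sum_(i <- B) `|u i| <= e%:C.
Proof.
move=> /cvgrPdist_lt cu e0.
(* Two partial sums within [e / 8] of the limit differ by at most [e / 4]; splitting by sign doubles
   this, and so does adding real and imaginary parts. *)
have e8 : 0 < (e / 8)%:C by rewrite ltcR divr_gt0.
have [A _ uA] := cu _ e8; exists A => B AB.
have sub_small (P : pred I) : `|\sum_(i <- B | P i) u i| <= (e / 4)%:C.
  pose B' := [fset i in B | P i]%fset.
  have AB' : [disjoint A & B']%fset.
    apply/fdisjointP => i iA; rewrite !inE /=.
    by rewrite (negPf (fdisjointP AB _ iA)).
  have -> : \sum_(i <- B | P i) u i = partial_sum u (A `|` B')%fset - partial_sum u A.
    by rewrite partial_sumU // addrC addKr partial_sumE big_fset_condE.
  have h1 := uA (A `|` B')%fset (fsubsetUl _ _).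
  have h2 := uA A (fsubset_refl _).
  have -> : (e / 4)%:C = (e / 8)%:C + (e / 8)%:C.
    by rewrite -rmorphD /=; congr (_ %:C); field.
  rewrite (le_trans (ler_distD (lim (partial_sum u @ totally)) _ _)) //.
  by rewrite lerD ?(distrC _ (lim _)) // ltW.
have Re_small (P : pred I) : `|\sum_(i <- B | P i) complex.Re (u i)| <= e / 4.
  rewrite -lecR (le_trans _ (sub_small P)) //.
  by rewrite -(raddf_sum (@complex.Re R)) normc_ge_Re.
have Im_small (P : pred I) : `|\sum_(i <- B | P i) complex.Im (u i)| <= e / 4.
  rewrite -lecR (le_trans _ (sub_small P)) //.
  by rewrite -(raddf_sum (@complex.Im R)) normc_ge_Im.
rewrite (le_trans (ler_sum _ (fun i _ => normc_le_ReIm (u i)))) //.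
rewrite -rmorph_sum lecR big_split /=.
rewrite (le_trans (lerD (sum_norm_le_of_subsums Re_small)
  (sum_norm_le_of_subsums Im_small))) //.
lra.
Qed.

(** The limit is approached by partial sums over sets containing [A], whose excess over [A] is
    disjoint from [A]. *)
Lemma dist_sum_partial_sum_le u e A : cvg (partial_sum u @ totally) ->
  (forall B, [disjoint A & B]%fset -> \sum_(i <- B) `|u i| <= e%:C) ->
  `|summability.sum u - partial_sum u A| <= e%:C.
Proof.
move=> /cvgrPdist_lt cu uA; apply/ler_addgt0Pr => d d0.
have [C _ uC] := cu _ d0.
have := uC (A `|` (C `\` A))%fset; rewrite /= fsetUDl fsetDv fsetD0 => /(_ (fsubsetUr _ _)).
have AC : [disjoint A & C `\` A]%fset.
  by apply/fdisjointP => i iA; rewrite !inE iA.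
have {1}-> : (A `|` C = A `|` (C `\` A))%fset by rewrite fsetUDl fsetDv fsetD0.
rewrite partial_sumU // => lC.
rewrite (le_trans (ler_distD (partial_sum u A + partial_sum u (C `\` A)%fset) _ _)) //.
rewrite addrC lerD ?(ltW lC) // addrC addKr partial_sumE.
by rewrite (le_trans (ler_norm_sum _ _ _)) ?uA.
Qed.

End UnconditionalConvergence.

(** * Coefficient bounds on a circular domain *)

Section Modulus.
Variable R : realType.
Implicit Types (x y : R[i]) (r : R).

Definition modulus x : R := complex.Re `|x|.

Lemma normc_modulus x : `|x| = (modulus x)%:C.
Proof. by rewrite /modulus normc_def. Qed.

Lemma normc_le x r : (`|x| <= r%:C) = (modulus x <= r).
Proof. by rewrite normc_modulus lecR. Qed.

Lemma normc_lt x r : (`|x| < r%:C) = (modulus x < r).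
Proof. by rewrite normc_modulus ltcR. Qed.

Lemma modulus_ge0 x : 0 <= modulus x.
Proof. by rewrite -lecR -normc_modulus normr_ge0. Qed.

Lemma modulus1 : modulus 1 = 1.
Proof. by rewrite /modulus normr1. Qed.

Lemma modulus_real r : 0 <= r -> modulus r%:C = r.
Proof. by move=> r0; rewrite /modulus ger0_norm // lecR. Qed.

Lemma modulusM x y : modulus (x * y) = modulus x * modulus y.
Proof.
by apply: complexI; rewrite rmorphM -!normc_modulus -normrM.
Qed.

Lemma modulusX x k : modulus (x ^+ k) = modulus x ^+ k.
Proof.
elim: k => [|k IH]; first exact: modulus1.
by rewrite !exprS modulusM IH.
Qed.

End Modulus.

Section Domain.
Variables (R : realType) (n : nat).
Implicit Types (D : set 'rV[R[i]]_n) (c : {ffun 'I_n -> nat} -> R[i])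
  (z : 'rV[R[i]]_n) (a : {ffun 'I_n -> nat}).
Local Notation index0 := (@index0 n).

(** Completeness puts the origin in [D], and openness a sup-norm ball around it; half its radius
    gives a closed polydisc. *)
Lemma circular_domain_polydisc D : complete_circular_domain D ->
  exists2 rho : R, 0 < rho &
    forall z, (forall j, modulus (z ord0 j) <= rho) -> D z.
Proof.
move=> [[z0 Dz0] oD _ cD].
have D0 : D 0 by apply: cD Dz0 _ => j; rewrite mxE normr0.
have /nbhs_ballP[e /= e0 eD] : nbhs (0 : 'rV[R[i]]_n) D by exact: open_nbhs_nbhs.
have er : e = (complex.Re e)%:C.
  by case: e e0 {eD} => x y; rewrite ltcE /= => /andP[/eqP -> _].
have r0 : 0 < complex.Re e by rewrite -ltcR -er.
exists (complex.Re e / 2); first by rewrite divr_gt0.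
move=> z zr; apply: eD; split => // i j.
rewrite ord1 mxE /ball /= sub0r normrN er normc_lt (le_lt_trans (zr j)) //.
by rewrite ltr_pdivrMr // mulr_natr mulr2n ltrDl.
Qed.

Lemma bounded_modulus_coord D : bounded_set D ->
  exists2 M : R, 0 < M & forall z j, D z -> modulus (z ord0 j) <= M.
Proof.
move=> [M [Mr DM]].
exists (`|complex.Re M| + 1); first by rewrite ltr_wpDl.
move=> z j Dz; rewrite -normc_le.
have MM : M < (`|complex.Re M| + 1)%:C.
  have -> : M = (complex.Re M)%:C by rewrite RRe_real.
  by rewrite ltcR ltr_pwDr // ler_norm.
apply: le_trans (DM _ MM _ Dz).
rewrite [leRHS]/Num.norm /= mx_normE -[leLHS]nngE num_le.
exact: (le_bigmax _ (fun ij : 'I_1 * 'I_n => `|z ij.1 ij.2|%:nng) (ord0, j)).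
Qed.

Lemma monomial0 a : a != index0 -> monomial a (0 : 'rV[R[i]]_n) = 0.
Proof.
move=> a0; have /existsP[j aj] : [exists j, a j != 0%N].
  apply: contraNT a0; rewrite negb_exists => /forallP a0.
  by apply/eqP/ffunP => j; rewrite ffunE; apply/eqP; have := a0 j; rewrite negbK.
by rewrite /monomial (bigD1 j) //= mxE expr0n (negPf aj) mul0r.
Qed.

Lemma monomial_index0 z : monomial index0 z = 1.
Proof. by rewrite /monomial big1 // => j _; rewrite ffunE expr0. Qed.

Lemma power_series_sum0 c :
  cvg (partial_sum (power_series_terms c 0) @ totally) ->
  power_series_sum c 0 = c index0.
Proof.
move=> cc; have t0 a : a != index0 -> power_series_terms c 0 a = 0.
  by move=> a0; rewrite /power_series_terms monomial0 // mulr0.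
(* All other terms vanish at the origin, so the tail estimate applies with error 0. *)
suff : `|power_series_sum c 0 - c index0| <= 0%:C.
  by rewrite normr_le0 subr_eq0 => /eqP.
have -> : c index0 = partial_sum (power_series_terms c 0) [fset index0]%fset.
  by rewrite partial_sumE big_seq_fset1 /power_series_terms monomial_index0 mulr1.
apply: dist_sum_partial_sum_le => // B /fdisjointP dB.
rewrite big1_fset // => a aB _; rewrite t0 ?normr0 //.
by apply: contraL aB => /eqP ->; apply: dB; rewrite inE.
Qed.

Lemma modulus_coef0_lt1 D c : complete_circular_domain D ->
  power_series_cvg_in D c ->
  (forall z, D z -> `|power_series_sum c z| < 1) -> modulus (c index0) < 1.
Proof.
move=> [[z Dz] _ _ cD] cc c1.
have D0 : D 0 by apply: cD Dz _ => j; rewrite mxE normr0.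
by rewrite -normc_lt -(power_series_sum0 (cc _ D0)) c1.
Qed.

Lemma monomial_row_mul z (w : 'I_n -> R[i]) a :
  monomial a (\row_j (w j * z ord0 j)) = monomial a z * \prod_j w j ^+ a j.
Proof.
rewrite /monomial -big_split /=; apply: eq_bigr => j _.
by rewrite mxE exprMn mulrC.
Qed.

(** A large finite partial sum is at most [1 + e] on the torus through [z]. The finite coefficient
    bound with [M = 1 + e] applies to it, and [e] then tends to 0. *)
Lemma power_series_coef_bound D c z m (T : seq {ffun 'I_n -> nat}) :
  complete_circular_domain D -> power_series_cvg_in D c ->
  (forall z, D z -> `|power_series_sum c z| < 1) ->
  D z -> (0 < m)%N -> uniq T -> {in T, forall a, degree a = m} ->
  \sum_(a <- T) modulus (power_series_terms c z a) ^+ 2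
    <= (1 - modulus (c index0) ^+ 2) ^+ 2.
Proof.
move=> DD cc c1 Dz m0 uT Tm.
have c01 := modulus_coef0_lt1 DD cc c1.
have [_ _ _ cD] := DD.
set u := power_series_terms c z; set s := modulus (c index0).
have u0 : u index0 = c index0 by rewrite /u /power_series_terms monomial_index0 mulr1.
have bound e : 0 < e ->
    (\sum_(a <- T) modulus (u a) ^+ 2) * (1 + e) ^+ 2 <= ((1 + e) ^+ 2 - s ^+ 2) ^+ 2.
  move=> e0; have [A uA] := cvg_partial_sum_tail (cc _ Dz) e0.
  pose S := (index0 |` (A `|` [fset a in T]))%fset.
  have := @homogeneous_coef_bound R[i] n (enum_fset S) T u (1 + e)%:C m.
  rewrite fset_uniq !inE eqxx /= u0 normc_lt => /(_ isT isT m0).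
  rewrite (lt_trans c01) ?ltrDl // => /(_ isT).
  have -> : \sum_(a <- T) `|u a| ^+ 2 = (\sum_(a <- T) modulus (u a) ^+ 2)%:C.
    by rewrite rmorph_sum /=; apply: eq_bigr => a _; rewrite rmorphXn /= -normc_modulus.
  rewrite normc_modulus -/s -!rmorphXn /= -rmorphB -rmorphM -rmorphXn lecR; apply => //.
    (* Completeness keeps the torus through [z] inside [D], and rotating coordinates preserves the
       modulus of every term, so the same [A] controls all tails. *)
    move=> w w1; pose z' : 'rV[R[i]]_n := \row_j (w j * z ord0 j).
    have Dz' : D z' by apply: cD Dz _ => j; rewrite mxE normrM w1 mul1r.
    have uE a : u a * \prod_j w j ^+ a j = power_series_terms c z' a.
      by rewrite /u /power_series_terms monomial_row_mul mulrA.
    have nE a : `|power_series_terms c z' a| = `|u a|.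
      rewrite -uE normrM normr_prod big1 ?mulr1 // => j _.
      by rewrite normrX w1 expr1n.
    under eq_bigr do rewrite uE.
    rewrite -partial_sumE rmorphD /=.
    have := dist_sum_partial_sum_le (A := S) (e := e) (cc _ Dz').
    have uS B : [disjoint S & B]%fset ->
        \sum_(a <- B) `|power_series_terms c z' a| <= e%:C.
      under eq_bigr do rewrite nE.
      move=> SB; apply/uA/fdisjointP => a aA.
      by apply: (fdisjointP SB); rewrite !inE aA orbT.
    move=> /(_ uS) h; rewrite -[X in `|X|](subKr (power_series_sum c z')).
    by rewrite (le_trans (ler_normB _ _)) // lerD // ltW // c1.
  by move=> a aT; rewrite !inE aT !orbT.
have s0 : 0 <= s by exact: modulus_ge0.
set X := \sum_(a <- T) _ in bound *.
apply/ler_addgt0Pr => d d0.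
have X0 : 0 <= X by apply: sumr_ge0 => a _; rewrite sqr_ge0.
(* With [f = (2 + e) * e <= 3 * e], the right side exceeds its limit by at most
   [2 * f + f ^ 2 <= 15 * e]. *)
have [e [e0 e1 ed]] : exists e : R, [/\ 0 < e, e <= 1 & 15 * e <= d].
  exists (Num.min 1 (d / 15)); rewrite lt_min ltr01 divr_gt0 // ge_min lexx.
  by split => //; rewrite mulrC -ler_pdivlMr // ge_min lexx orbT.
have s1 : s ^+ 2 <= 1 by rewrite expr_le1 // ltW.
have s20 : 0 <= s ^+ 2 by rewrite sqr_ge0.
apply: le_trans (le_trans (bound e e0) _).
  by rewrite ler_peMr // exprn_ege1 // lerDl ltW.
move: (s ^+ 2) s1 s20 => q q1 q0.
have -> : (1 + e) ^+ 2 - q = (1 - q) + (2 + e) * e by ring.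
have f3 : (2 + e) * e <= 3 * e by nra.
have f0 : 0 <= (2 + e) * e by nra.
move: ((2 + e) * e) f0 f3 => f f0 f3.
nra.
Qed.

End Domain.

(** * Geometric sums over multi-indices *)

Lemma sum_geometric_le (R : realType) (r : R) N : 0 <= r -> r < 1 ->
  \sum_(k < N) r ^+ k <= (1 - r)^-1.
Proof.
move=> r0 r1; rewrite -[leRHS]mul1r ler_pdivlMr ?subr_gt0 //.
have -> : (\sum_(k < N) r ^+ k) * (1 - r) = 1 - r ^+ N.
  by rewrite -[RHS]opprB subrX1 -mulNr opprB mulrC.
by rewrite gerBl exprn_ge0.
Qed.

Section MultiIndexSum.
Variables (R : realType) (n : nat).
Local Notation index := {ffun 'I_n -> nat}.

(** [S] fits into a finite box, over which the sum factors into [n] geometric sums in one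
    variable. *)
Lemma sum_expr_degree_le (r : R) (S : seq index) : 0 <= r -> r < 1 -> uniq S ->
  \sum_(a <- S) r ^+ degree a <= (1 - r)^-1 ^+ n.
Proof.
move=> r0 r1 uS.
pose N := (\max_(a <- S) degree a)%N.
pose emb (f : {ffun 'I_n -> 'I_N.+1}) : index := [ffun j => nat_of_ord (f j)].
have emb_inj : injective emb.
  by move=> f g /ffunP fg; apply/ffunP => j; apply: val_inj; have := fg j; rewrite !ffunE.
have St : {subset S <= map emb (enum {ffun 'I_n -> 'I_N.+1})}.
  move=> a aS; apply/mapP; exists [ffun j => inord (a j)]; first by rewrite mem_enum.
  apply/ffunP => j; rewrite !ffunE inordK // ltnS.
  by rewrite (leq_trans (leq_degree a j)) // (leq_bigmax_seq (F := @degree n)).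
apply: le_trans (ler_sum_uniq_sub uS _ St _) _.
- by rewrite map_inj_uniq // enum_uniq.
- by move=> a; rewrite exprn_ge0.
rewrite big_map big_enum /=.
rewrite (eq_bigr (fun f : {ffun 'I_n -> 'I_N.+1} => \prod_j r ^+ f j)); last first.
  by move=> f _; rewrite /degree expr_sum; apply: eq_bigr => j _; rewrite ffunE.
rewrite -(bigA_distr_bigA (fun (j : 'I_n) (k : 'I_N.+1) => r ^+ k)) /=.
rewrite prodr_const card_ord; apply: lerXn2r; rewrite ?nnegrE.
- by apply: sumr_ge0 => k _; rewrite exprn_ge0.
- by rewrite invr_ge0 subr_ge0 ltW.
- exact: sum_geometric_le.
Qed.

End MultiIndexSum.

(** * The gain from two quadratic monomials *)

Section QuadraticCoefficients.
Variables (R : realType) (n : nat).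
Implicit Types (D : set 'rV[R[i]]_n) (c : {ffun 'I_n -> nat} -> R[i])
  (z : 'rV[R[i]]_n) (a b : {ffun 'I_n -> nat}).

Definition index_unit (i : 'I_n) : {ffun 'I_n -> nat} := [ffun j => (j == i : nat)].
Definition index_add a b : {ffun 'I_n -> nat} := [ffun j => (a j + b j)%N].

Lemma degree_unit i : degree (index_unit i) = 1%N.
Proof.
rewrite /degree (bigD1 i) //= ffunE eqxx big1 // => j /negPf ji.
by rewrite ffunE ji.
Qed.

Lemma degree_add a b : degree (index_add a b) = (degree a + degree b)%N.
Proof. by rewrite /degree -big_split; apply: eq_bigr => j _; rewrite ffunE. Qed.

Lemma monomial_unit i z : monomial (index_unit i) z = z ord0 i.
Proof.
rewrite /monomial (bigD1 i) //= ffunE eqxx expr1 big1 ?mulr1 // => j /negPf ji.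
by rewrite ffunE ji expr0.
Qed.

Lemma monomial_add a b z :
  monomial (index_add a b) z = monomial a z * monomial b z.
Proof.
by rewrite /monomial -big_split; apply: eq_bigr => j _; rewrite ffunE exprD.
Qed.

(** If the [be] term stays below [s / 2], take [be]. Otherwise [c be] is bounded below, and [al]
    works: where the coordinate [i0] is at least [k], the [be] term takes a fixed share of the
    Parseval sum; elsewhere the [al] monomial itself is small. *)
Lemma quadratic_coef_improvement D (i0 i1 : 'I_n) : i0 != i1 ->
  complete_circular_domain D -> bounded_set D ->
  exists2 eps : R, 0 < eps <= 1 & forall c, power_series_cvg_in D c ->
    (forall z, D z -> `|power_series_sum c z| < 1) ->
    exists2 g, degree g = 2 & forall z, D z ->
      modulus (power_series_terms c z g)
        <= (1 - eps) * (1 - modulus (c (index0 n)) ^+ 2).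
Proof.
move=> i01 cD bD.
have [rho rho0 Drho] := circular_domain_polydisc cD.
have [M M0 DM] := bounded_modulus_coord bD.
pose al := index_add (index_unit i0) (index_unit i1).
pose be := index_add (index_unit i0) (index_unit i0).
have al2 : degree al = 2 by rewrite degree_add !degree_unit.
have be2 : degree be = 2 by rewrite degree_add !degree_unit.
have albe : al != be.
  apply/negP => /eqP/ffunP/(_ i0).
  by rewrite !ffunE eqxx (negPf i01).
have Eal c z : modulus (power_series_terms c z al) =
    modulus (c al) * (modulus (z ord0 i0) * modulus (z ord0 i1)).
  by rewrite /power_series_terms !modulusM monomial_add !monomial_unit modulusM.
have Ebe c z : modulus (power_series_terms c z be) =
    modulus (c be) * (modulus (z ord0 i0) * modulus (z ord0 i0)).
  by rewrite /power_series_terms !modulusM monomial_add !monomial_unit modulusM.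
(* Chosen so that [k * M = rho ^ 2 / 2], half the value of the [al] monomial at a corner of the
   polydisc. *)
pose k := rho ^+ 2 / (2 * M).
have k0 : 0 < k by rewrite divr_gt0 ?exprn_gt0 ?mulr_gt0.
(* [del * s] is the lower bound for the [be] term where the coordinate [i0] has modulus at least
   [k]. *)
pose del := k ^+ 2 / (2 * M ^+ 2).
have del0 : 0 < del.
  by apply: divr_gt0; [exact: exprn_gt0|apply: mulr_gt0; [|exact: exprn_gt0]].
(* [eps <= 1 / 2] covers the cases with bound [s / 2]; [2 * eps <= del ^ 2] gives
   [1 - del ^ 2 <= (1 - eps) ^ 2]. *)
have [eps [eps0 eps2 epsd]] : exists eps : R,
    [/\ 0 < eps, eps <= 1 / 2 & 2 * eps <= del ^+ 2].
  exists (Num.min (1 / 2) (del ^+ 2 / 2)).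
  rewrite lt_min !divr_gt0 ?exprn_gt0 // ge_min lexx; split => //.
  by rewrite mulrC -ler_pdivlMr // ge_min lexx orbT.
exists eps; first by rewrite eps0; lra.
move=> c cc c1.
set s := 1 - _ ^+ 2.
have coef_le a z : D z -> degree a = 2 ->
    modulus (power_series_terms c z a) ^+ 2 <= s ^+ 2.
  move=> Dz a2.
  have := @power_series_coef_bound R n D c z 2 [:: a] cD cc c1 Dz isT isT.
  by rewrite big_seq1; apply => b; rewrite inE => /eqP ->.
have pair_le z : D z -> modulus (power_series_terms c z al) ^+ 2
    + modulus (power_series_terms c z be) ^+ 2 <= s ^+ 2.
  move=> Dz.
  have := @power_series_coef_bound R n D c z 2 [:: al; be] cD cc c1 Dz isT.
  rewrite /= inE albe big_cons big_seq1; apply => // b.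
  by rewrite !inE => /orP[] /eqP ->.
have s0 : 0 <= s.
  by rewrite subr_ge0 expr_le1 ?modulus_ge0 // ltW // (modulus_coef0_lt1 cD cc c1).
have [beS|/existsNP[z' /not_implyP[Dz' /negP]]] := pselect (forall z, D z ->
    modulus (power_series_terms c z be) <= s / 2).
  by exists be => // z Dz; rewrite (le_trans (beS _ Dz)) //; nra.
rewrite -ltNge => big_be; exists al => // z Dz.
have cbe : s <= modulus (c be) * (2 * M ^+ 2).
  have xM : modulus (z' ord0 i0) * modulus (z' ord0 i0) <= M ^+ 2.
    by rewrite -expr2 lerXn2r ?nnegrE ?modulus_ge0 ?(ltW M0) ?DM.
  have := ler_wpM2l (modulus_ge0 (c be)) xM; rewrite -Ebe; lra.
have cal : modulus (c al) * rho ^+ 2 <= s.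
  pose zr : 'rV[R[i]]_n := const_mx rho%:C.
  have Dzr : D zr by apply: Drho => j; rewrite mxE modulus_real // ltW.
  have := coef_le al zr Dzr al2; rewrite ler_sqr ?nnegrE ?modulus_ge0 //.
  by rewrite Eal !mxE (modulus_real (ltW rho0)) -expr2.
set x := modulus (z ord0 i0); set y := modulus (z ord0 i1).
have x0 : 0 <= x by exact: modulus_ge0.
have y0 : 0 <= y by exact: modulus_ge0.
have [xk|xk] := leP k x.
  have del_le : del * s <= modulus (power_series_terms c z be).
    rewrite Ebe -/x /del mulrAC ler_pdivrMr ?mulr_gt0 ?exprn_gt0 //.
    have kx : k ^+ 2 <= x * x by rewrite -expr2 lerXn2r ?nnegrE ?(ltW k0).
    have cM0 : 0 <= modulus (c be) * (2 * M ^+ 2) by exact: le_trans cbe.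
    have -> : modulus (c be) * (x * x) * (2 * M ^+ 2)
      = x * x * (modulus (c be) * (2 * M ^+ 2)) by ring.
    by rewrite ler_pM ?exprn_ge0 ?(ltW k0).
  have del_le2 : (del * s) ^+ 2 <= modulus (power_series_terms c z be) ^+ 2.
    have ds0 : 0 <= del * s by exact: mulr_ge0 (ltW del0) s0.
    by rewrite lerXn2r ?nnegrE ?modulus_ge0.
  have := pair_le z Dz; set t := modulus (power_series_terms c z al) => ts.
  have t0 : 0 <= t by exact: modulus_ge0.
  rewrite -(@ler_pXn2r _ 2) ?nnegrE ?mulr_ge0 //; last by lra.
  rewrite [(del * s) ^+ 2](exprMn 2 del s) in del_le2; rewrite exprMn.
  have s20 := sqr_ge0 s.
  have : 2 * eps * s ^+ 2 <= del ^+ 2 * s ^+ 2 by rewrite ler_wpM2r.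
  have : 0 <= eps ^+ 2 * s ^+ 2 by rewrite mulr_ge0 ?sqr_ge0.
  have -> : (1 - eps) ^+ 2 * s ^+ 2
    = s ^+ 2 - 2 * eps * s ^+ 2 + eps ^+ 2 * s ^+ 2 by ring.
  move: ts del_le2; lra.
rewrite Eal -/x -/y.
have yM : y <= M by exact: DM.
have xy : x * y <= rho ^+ 2 / 2.
  have -> : rho ^+ 2 / 2 = k * M by rewrite /k; field; rewrite gt_eqF.
  by rewrite ler_pM // ltW.
have := ler_wpM2l (modulus_ge0 (c al)) xy.
nra.
Qed.

End QuadraticCoefficients.

(** * The majorant series and the Bohr radius *)

Section Majorant.
Variables (R : realType) (n : nat).
Implicit Types (D : set 'rV[R[i]]_n) (c : {ffun 'I_n -> nat} -> R[i])
  (z : 'rV[R[i]]_n) (a g : {ffun 'I_n -> nat}) (r : R).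
Local Notation index0 := (@index0 n).

Lemma monomialZ (x : R[i]) z a : monomial a (x *: z) = x ^+ degree a * monomial a z.
Proof.
rewrite /monomial /degree expr_sum -big_split /=; apply: eq_bigr => j _.
by rewrite mxE exprMn.
Qed.

Lemma majorant_term_le D c r a (K : R) : 0 <= r ->
  (forall z, D z -> modulus (power_series_terms c z a) <= K) ->
  (ereal_sup [set (complex.Re `|power_series_terms c z a|)%:E | z in dilation r D]
    <= (K * r ^+ degree a)%:E)%E.
Proof.
move=> r0 cK; apply: ge_ereal_sup => _ [_ [z Dz <-] <-]; rewrite lee_fin.
rewrite /power_series_terms monomialZ mulrCA -/(modulus _) modulusM modulusX.
by rewrite modulus_real // mulrC ler_wpM2r ?exprn_ge0 // cK.
Qed.

(** The constant term contributes [t], the term of index [g] carries the factor [1 - eps], and every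
    other term is at most [s * r ^ degree a]. *)
Lemma majorant_series_le D c g r eps : complete_circular_domain D ->
  power_series_cvg_in D c ->
  (forall z, D z -> `|power_series_sum c z| < 1) ->
  0 < r < 1 -> eps <= 1 -> (0 < degree g)%N ->
  (forall z, D z -> modulus (power_series_terms c z g)
    <= (1 - eps) * (1 - modulus (c index0) ^+ 2)) ->
  (majorant_series D c r <= (modulus (c index0) + (1 - modulus (c index0) ^+ 2)
     * ((1 - r)^-1 ^+ n - 1 - eps * r ^+ degree g))%:E)%E.
Proof.
move=> cD cc c1 /andP[r0 r1] eps1 g0 cg.
set t := modulus (c index0); set s := 1 - t ^+ 2.
have t0 : 0 <= t by exact: modulus_ge0.
have s0 : 0 <= s.
  by rewrite subr_ge0 expr_le1 // ltW // (modulus_coef0_lt1 cD cc c1).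
pose K a := if a == index0 then t else if a == g then (1 - eps) * s else s.
have K0 a : 0 <= K a.
  by rewrite /K; do 2 case: ifP => // _; rewrite mulr_ge0 // subr_ge0.
have Kc a z : D z -> modulus (power_series_terms c z a) <= K a.
  move=> Dz; rewrite /K; case: eqVneq => [->|a0].
    by rewrite /power_series_terms monomial_index0 mulr1.
  case: eqVneq => [->|_]; first exact: cg.
  have := @power_series_coef_bound R n D c z (degree a) [:: a] cD cc c1 Dz.
  rewrite lt0n degree_eq0 => /(_ a0 isT); rewrite big_seq1 ler_sqr ?nnegrE ?modulus_ge0 //.
  by apply => b; rewrite inE => /eqP ->.
have gn0 : g != index0 by rewrite -degree_eq0 -lt0n.
apply: ge_ereal_sup => _ [A [fA _] <-].
rewrite fsbig_finite //=.
apply: le_trans (lee_sum _ (fun a _ => majorant_term_le (ltW r0) (Kc a))) _.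
rewrite sumEFin lee_fin.
(* Enlarging the finite set by [index0] and [g] only increases the sum and makes each correction in
   [KE] occur exactly once. *)
pose S := (index0 |` (g |` fset_set A))%fset.
have AS : {subset enum_fset (fset_set A) <= enum_fset S}.
  by move=> a aA; rewrite !inE aA !orbT.
apply: le_trans (ler_sum_uniq_sub (fset_uniq _) (fset_uniq S) AS _) _.
  by move=> a; rewrite mulr_ge0 // exprn_ge0 // ltW.
have KE a : K a * r ^+ degree a = s * r ^+ degree a
    + ((if a == index0 then t - s else 0)
      + (if a == g then - (s * (eps * r ^+ degree g)) else 0)).
  rewrite /K; case: eqVneq => [->|a0].
    rewrite eq_sym (negPf gn0) (eqP (_ : degree index0 == 0)%N) ?degree_eq0 //.
    by rewrite expr0; ring.
  by case: eqVneq => [->|_]; ring.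
under eq_bigr do rewrite KE.
rewrite big_split big_split /= -!big_mkcond /= -mulr_sumr.
rewrite -big_filter filter_pred1_uniq ?fset_uniq ?inE ?eqxx // big_seq1.
rewrite -big_filter filter_pred1_uniq ?fset_uniq ?inE ?eqxx ?orbT // big_seq1.
have := ler_wpM2l s0 (sum_expr_degree_le (ltW r0) r1 (fset_uniq S)).
lra.
Qed.

(* The multiple of [z_i] of sup norm at most [1/2] rules out large [r]. *)
Lemma bohr_property_bounded D (i : 'I_n) : complete_circular_domain D ->
  bounded_set D -> has_ubound [set r | 0 < r /\ bohr_property D r].
Proof.
move=> cD bD.
have [rho rho0 Drho] := circular_domain_polydisc cD.
have [M M0 DM] := bounded_modulus_coord bD.
(* At the corner of the polydisc of radius [rho], the linear term alone makes the majorant at least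
   [r * rho / (2 * M)]. *)
exists (2 * M / rho) => r [r0 Br].
pose c a : R[i] := if a == index_unit i then (2 * M)^-1%:C else 0.
have cE z : power_series_terms c z (index_unit i) = (2 * M)^-1%:C * z ord0 i.
  by rewrite /power_series_terms /c eqxx monomial_unit.
have cvg_c z : partial_sum (power_series_terms c z) @ totally
    --> (2 * M)^-1%:C * z ord0 i.
  apply: cvg_near_cst; exists [fset index_unit i]%fset => //= B iB.
  rewrite partial_sumE -cE -(big_seq_fset1 +%R (index_unit i) (power_series_terms c z)).
  apply/esym/big_fset_incl => // a _; rewrite inE /power_series_terms /c => /negPf ->.
  by rewrite mul0r.
have M20 : 0 <= (2 * M)^-1 by rewrite invr_ge0 mulr_ge0 // ltW.
have c_lt1 z : D z -> `|power_series_sum c z| < 1.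
  move=> Dz; rewrite /power_series_sum /summability.sum (cvg_lim _ (cvg_c z)) //.
  apply: (@le_lt_trans _ _ (1 / 2)%:C); last by rewrite ltcR; lra.
  rewrite normc_le modulusM modulus_real //.
  have -> : 1 / 2 = (2 * M)^-1 * M :> R by field; rewrite gt_eqF.
  by rewrite ler_wpM2l // DM.
have cvg_in : power_series_cvg_in D c by move=> z _; apply/cvg_ex; eexists; exact: cvg_c.
have := Br c cvg_in c_lt1.
pose z : 'rV[R[i]]_n := const_mx rho%:C.
have Dz : D z by apply: Drho => j; rewrite mxE modulus_real // ltW.
have lower : ((r * rho / (2 * M))%:E <= majorant_series D c r)%E.
  apply: esum_ge; exists [set index_unit i]; first by split.
  rewrite fsbig_set1; apply: ereal_sup_ubound.
  exists (r%:C *: z); first by exists z.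
  congr (_%:E); rewrite -/(modulus _) cE !mxE !modulusM !modulus_real
    ?(ltW r0) ?(ltW rho0) //.
  by rewrite mulrC.
move=> /(le_lt_trans lower); rewrite lte_fin ltr_pdivrMr ?mulr_gt0 // mul1r => h.
by rewrite ler_pdivlMr // ltW.
Qed.

End Majorant.

Lemma powR_invn_exp (R : realType) (x : R) n : 0 <= x -> (0 < n)%N ->
  (x `^ n%:R^-1) ^+ n = x.
Proof.
move=> x0 n0; rewrite -powR_mulrn ?powR_ge0 // -powRrM mulVf ?powRr1 //.
by rewrite pnatr_eq0 -lt0n.
Qed.

Theorem theorem4 (R : realType) (n : nat) (D : set 'rV[R[i]]_n) :
  (2 <= n)%N ->
  complete_circular_domain D ->
  bounded_set D ->
  1 - (2 / 3) `^ (n%:R^-1) < bohr_radius D.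
Proof.
move=> n2 cD bD.
have n0 : (0 < n)%N by exact: ltn_trans n2.
pose i0 := Ordinal n0; pose i1 := Ordinal n2.
have i01 : i0 != i1 by [].
have [eps /andP[eps0 eps1] improve] := quadratic_coef_improvement i01 cD bD.
set r0 := 1 - _.
have powR_lt1 (x : R) : 0 < x < 1 -> 0 < x `^ n%:R^-1 < 1.
  move=> /andP[x0 x1]; rewrite powR_gt0 //=.
  rewrite -(@ltr_pXn2r _ n) ?nnegrE ?powR_ge0 //.
  by rewrite powR_invn_exp ?ltW // expr1n.
have /andP[p0 p1] : 0 < (2 / 3 : R) `^ n%:R^-1 < 1 by apply: powR_lt1; lra.
have r00 : 0 < r0 by rewrite subr_gt0.
(* [q] will be [(1 - r) ^ (- n)]. Its excess over [3 / 2] is what the improved term saves, computed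
   at [r0], which is fixed before [r]; the saving at [r > r0] is at least as large. *)
pose q := 3 / 2 + eps * r0 ^+ 2.
have er0 : 0 < eps * r0 ^+ 2 by rewrite mulr_gt0 ?exprn_gt0.
have q0 : 0 < q by rewrite /q; lra.
have q1 : q^-1 < 2 / 3.
  by rewrite -[ltRHS]invf_div ltf_pV2 ?posrE ?divr_gt0 // ltrDl.
have qi0 : 0 < q^-1 by rewrite invr_gt0.
have /andP[t0 t1] : 0 < q^-1 `^ n%:R^-1 < 1.
  by apply: powR_lt1; rewrite qi0 (lt_trans q1) //; lra.
pose r := 1 - q^-1 `^ n%:R^-1.
have r0r : r0 < r.
  rewrite ltrD2l ltrN2 -(@ltr_pXn2r _ n) ?nnegrE ?powR_ge0 //.
  by rewrite !powR_invn_exp ?(ltW qi0) //; lra.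
apply: (lt_le_trans r0r).
(* [sup] dominates its elements only for a set bounded above; otherwise it is a default value. *)
apply: ub_le_sup; first exact: bohr_property_bounded i0 cD bD.
have rpos : 0 < r by rewrite subr_gt0.
split => // c cc c1.
have [g g2 cg] := improve c cc c1.
have c01 := modulus_coef0_lt1 cD cc c1.
have := @majorant_series_le R n D c g r eps cD cc c1.
rewrite rpos gtrBl t0 g2 => /(_ isT eps1 isT cg) /le_lt_trans; apply.
rewrite lte_fin /r subKr exprVn powR_invn_exp ?(ltW qi0) // invrK.
have er : eps * r0 ^+ 2 <= eps * (1 - q^-1 `^ n%:R^-1) ^+ 2.
  rewrite -/r; apply: ler_wpM2l; first exact: ltW.
  by apply: lerXn2r; rewrite ?nnegrE; exact: ltW.
set t := modulus _ in c01 *.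
have t00 : 0 <= t by exact: modulus_ge0.
have t20 : 0 <= 1 - t ^+ 2 by rewrite subr_ge0 expr_le1 // ltW.
set x := q - 1 - _.
have x2 : x <= 1 / 2 by rewrite /x /q; lra.
have := ler_wpM2l t20 x2.
(* This is [t + (1 - t ^ 2) / 2 < 1] in disguise. *)
have : 0 < (1 - t) ^+ 2 by rewrite exprn_gt0 // subr_gt0.
have -> : (1 - t) ^+ 2 = 1 - 2 * t + t ^+ 2 by ring.
lra.
Qed.
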